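(* Let $Y\sim\mathrm{GMN}_d(\xi,\Sigma,\gamma,H)$, let $q\le d$, let $b\in\mathbb{R}^q$ and let $B$ be a real $d\times q$ matrix of full rank. Then $$b+B^{\top}Y\sim \mathrm{GMN}_q\left(b+B^{\top}\xi,\;B^{\top}\Sigma B,\;B^{\top}\gamma,\;H\right),$$ i.e. $b+B^\top Y$ is again a member of the GMN class, with the same mixing distribution $H$ as $Y$.
   Context: Generalized mixtures of normals (GMN). Let $\Sigma$ be a $d\times d$ symmetric positive definite matrix and $\xi,\gamma\in\mathbb{R}^d$. Let $X\sim\mathrm{N}_d(0,\Sigma)$ be a $d$-dimensional normal variable and $U,V$ univariate random variables such that $X,U,V$ are mutually independent. Let $r(u,v)$ be a real-valued function and $s(u,v)$ a positive-valued function, and let $R=r(U,V)$, $S=s(U,V)$ be the resulting random variables, so that $(R,S)$ is independent of $X$. Denote by $H$ the joint distribution (function) of $(R,S)$. If $Y=\xi+R\,\gamma+S\,X$, one writes $Y\sim\mathrm{GMN}_d(\xi,\Sigma,\gamma,H)$; this notation identifies the distribution of $Y$. *)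

(* Defs.v *)
From HB Require Import structures.
From mathcomp Require Import all_boot all_order all_algebra.
From mathcomp Require Import all_classical all_reals all_analysis.

Set Implicit Arguments.
Unset Strict Implicit.
Unset Printing Implicit Defensive.

Import Order.TTheory GRing.Theory Num.Theory.
Import numFieldNormedType.Exports.

Local Open Scope classical_set_scope.
Local Open Scope ring_scope.

(* Vectors of R^n are column vectors. They carry the product sigma-algebra,
   generated by the n coordinates, i.e. the Borel sigma-algebra of R^n; the
   construction mirrors the library's sigma-algebra on n.-tuple T. *)
Definition measure_cV_display : measure_display. Proof. exact. Qed.

Section measurable_cV.
Context {R : realType} (n : nat).

Let coord (i : 'I_n) (x : 'cV[R]_n) : R := x i 0.

Let cV_set0 : g_sigma_preimage coord set0.
Proof. exact: sigma_algebra0. Qed.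

Let cV_setC A : g_sigma_preimage coord A -> g_sigma_preimage coord (~` A).
Proof. exact: sigma_algebraC. Qed.

Let cV_bigcup (F : _^nat) : (forall i, g_sigma_preimage coord (F i)) ->
  g_sigma_preimage coord (\bigcup_i F i).
Proof. exact: sigma_algebra_bigcup. Qed.

HB.instance Definition _ := @isMeasurable.Build measure_cV_display
  'cV[R]_n (g_sigma_preimage coord) cV_set0 cV_setC cV_bigcup.

End measurable_cV.

Definition cons_cV {R : realType} n (p : measurableTypeR R * 'cV[R]_n) :
  'cV[R]_n.+1 := col_mx p.1%:M p.2.

(* On R^0, a single point, Lebesgue measure is the unit mass. *)
Fixpoint lebesgue_cV {R : realType} n : set 'cV[R]_n -> \bar R :=
  if n is n'.+1 then
    pushforward (lebesgue_measure \x @lebesgue_cV R n')%E (@cons_cV R n')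
  else \d_(0 : 'cV[R]_0).

Definition posdefmx {R : realType} n (A : 'M[R]_n) : Prop :=
  A^T = A /\ forall x : 'cV[R]_n, x != 0 -> 0 < (x^T *m A *m x) 0 0.

Definition normal_cV_pdf {R : realType} n (m : 'cV[R]_n) (Sigma : 'M[R]_n)
    (x : 'cV[R]_n) : R :=
  (Num.sqrt ((2 * pi) ^+ n * \det Sigma))^-1 *
  expR (- ((x - m)^T *m invmx Sigma *m (x - m)) 0 0 / 2).

(* Only the non-degenerate normal laws, which have a Lebesgue density. *)
Definition is_normal_cV {R : realType} n (m : 'cV[R]_n) (Sigma : 'M[R]_n)
    d (T : measurableType d) (P : probability T R)
    (X : {RV P >-> 'cV[R]_n}) : Prop :=
  posdefmx Sigma /\
  forall A, measurable A ->
    distribution P X A =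
    (\int[@lebesgue_cV R n]_(x in A) (normal_cV_pdf m Sigma x)%:E)%E.

(* Mutual independence; the product rule for pairs is the case where one of
   the three sets is the whole space. *)
Definition independent3 {R : realType} d (T : measurableType d)
    (P : probability T R) d1 (T1 : measurableType d1) d2
    (T2 : measurableType d2) d3 (T3 : measurableType d3)
    (X1 : {RV P >-> T1}) (X2 : {RV P >-> T2}) (X3 : {RV P >-> T3}) : Prop :=
  forall A1 A2 A3, measurable A1 -> measurable A2 -> measurable A3 ->
    P (X1 @^-1` A1 `&` X2 @^-1` A2 `&` X3 @^-1` A3) =
    (P (X1 @^-1` A1) * P (X2 @^-1` A2) * P (X3 @^-1` A3))%E.

(* Y ~ GMN_n(xi, Sigma, gamma, H). This is a property of the distribution of
   Y: the variables X, U, V of the stochastic representation live on a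
   probability space that need not be the one on which Y is defined. *)
Definition is_GMN {R : realType} n (xi : 'cV[R]_n) (Sigma : 'M[R]_n)
    (gamma : 'cV[R]_n)
    (H : probability (R * R)%type R)
    d (T : measurableType d) (P : probability T R)
    (Y : T -> 'cV[R]_n) : Prop :=
  measurable_fun [set: T] Y /\
  exists (d' : measure_display) (T' : measurableType d')
    (P' : probability T' R) (X : {RV P' >-> 'cV[R]_n})
    (U V : {RV P' >-> R})
    (r s : R * R -> R),
    let RS t := (r (U t, V t), s (U t, V t)) in
    [/\ is_normal_cV 0 Sigma X,
        independent3 X U V,
        [/\ measurable_fun setT r, measurable_fun setT s
          & forall uv, 0 < s uv],
        forall C, measurable C -> H C = pushforward P' RS C
      & forall A, measurable A -> pushforward P Y A =
          pushforward P'
            (fun t => xi + (RS t).1 *: gamma + (RS t).2 *: X t) A].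

(* Main.v *)
Require Import Defs.
From HB Require Import structures.
From mathcomp Require Import all_boot all_order all_algebra.
From mathcomp Require Import all_classical all_reals all_analysis.
From mathcomp Require Import measurable_realfun ring.

(** Applying [y |-> b + B^T y] to [xi + R gamma + S X] gives
    [(b + B^T xi) + R (B^T gamma) + S (B^T X)], and [B^T X] is still independent
    of the mixing variables, whose joint law is untouched. What remains is that
    a full-rank linear image of a non-degenerate centred normal vector with
    covariance [Sigma] has the density of the normal law with covariance
    [B^T Sigma B] ([integral_normal_image]).

    Complete [B^T] to an invertible matrix [M] whose last rows are those of
    [B^T]. The change of variables [x |-> M x] carries the density with
    covariance [Sigma] to the one with covariance [M Sigma M^T]
    ([normal_cV_pdf_congr]), and [B^T x] consists of the last coordinates of
    [M x]. Integrating out the other coordinates one by one, by conditioning on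
    the remaining ones ([normal_marginal]), leaves the density whose covariance
    is the lower right block of [M Sigma M^T], which is [B^T Sigma B].

    The change of variables formula for Lebesgue measure
    ([linear_change_unit]) is proved by Gaussian elimination: invertible
    matrices are products of block triangular ones, and for these Tonelli's
    theorem reduces the formula to lower dimensions and to affine substitution
    on the line. *)

Import Order.TTheory GRing.Theory Num.Theory.
Import numFieldNormedType.Exports.
Local Open Scope classical_set_scope.
Local Open Scope ring_scope.

(** * Measurability in coordinates *)

Section Measurability.
Context {R : realType}.

Lemma measurable_coord n (i : 'I_n) :
  measurable_fun [set: 'cV[R]_n] (fun x : 'cV[R]_n => x i 0).
Proof.
case: n i => [[]//|n] i _ A mA.
apply: sub_sigma_algebra; rewrite -bigcup_mkord_ord.
by exists i; [exact: ltn_ord|exists A => //; rewrite inord_val].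
Qed.

(** The sigma-algebra is the smallest one that makes the coordinates measurable,
    so measurability into column vectors is a coordinatewise matter. *)
Lemma measurable_fun_cVP d (T : measurableType d) n (f : T -> 'cV[R]_n) :
  measurable_fun setT f <-> forall i, measurable_fun setT (fun t => f t i 0).
Proof.
split=> [mf i|mf]; first exact: (measurableT_comp (measurable_coord n i)).
have sub : g_sigma_preimage (fun i => (fun x : 'cV[R]_n => x i 0) \o f)
    `<=` measurable.
  apply: smallest_sub; first exact: sigma_algebra_measurable.
  case: n f mf => [|n] f mf; first by rewrite big_ord0.
  rewrite -bigcup_mkord_ord; apply: bigcup_sub => i _.
  by move=> A [B mB <-]; exact: (mf (inord i) measurableT B mB).
move: sub; rewrite g_sigma_preimage_comp => sub _ A mA.
by apply: sub; exists A.
Qed.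

Lemma measurable_addmx n (v : 'cV[R]_n) :
  measurable_fun [set: 'cV[R]_n] (fun x => v + x).
Proof.
apply/measurable_fun_cVP => i; under eq_fun do rewrite mxE.
apply: measurable_funD => //; exact: measurable_coord.
Qed.

Lemma measurable_mulmx m n (A : 'M[R]_(m, n)) :
  measurable_fun [set: 'cV[R]_n] (fun x : 'cV[R]_n => A *m x).
Proof.
apply/measurable_fun_cVP => i; under eq_fun do rewrite mxE.
apply: measurable_sum => j; apply: measurable_funM => //.
exact: measurable_coord.
Qed.

Lemma measurable_dsubmx k q : measurable_fun setT (@dsubmx R k q 1).
Proof.
apply/measurable_fun_cVP => i.
apply: (eq_measurable_fun (fun x : 'cV[R]_(k + q) => x (rshift k i) 0)).
  by move=> x _; rewrite mxE.
exact: measurable_coord.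
Qed.

Lemma measurable_cons_cV n : measurable_fun setT (@cons_cV R n).
Proof.
apply/measurable_fun_cVP => i; case: (@split_ordP 1 n i) => j ->.
  apply: (eq_measurable_fun fst) => // -[t y] _ /=.
  by rewrite (@col_mxEu _ 1) ord1 mxE eqxx mulr1n.
apply: (eq_measurable_fun (fun p : _ * 'cV[R]_n => p.2 j 0)) => [[t y] _ /=|].
  by rewrite (@col_mxEd _ 1).
exact: (measurableT_comp (measurable_coord n j)).
Qed.

Definition uncons_cV {n} (x : 'cV[R]_n.+1) : measurableTypeR R * 'cV[R]_n :=
  (x 0 0, @dsubmx _ 1 _ _ x).

Lemma cons_cVK n : cancel (@cons_cV R n) (@uncons_cV n).
Proof.
move=> [t y]; rewrite /uncons_cV/cons_cV/=; congr (_, _); last first.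
  exact: (@col_mxKd _ 1).
have -> : (0 : 'I_n.+1) = @lshift 1 n 0 by exact: val_inj.
by rewrite (@col_mxEu _ 1) mxE eqxx mulr1n.
Qed.

Lemma uncons_cVK n : cancel (@uncons_cV n) (@cons_cV R n).
Proof.
move=> x; rewrite /uncons_cV/cons_cV/=; rewrite -[RHS](@vsubmxK _ 1).
suff -> : (x 0 0)%:M = @usubmx _ 1 _ _ x by [].
apply/matrixP => i j; rewrite !ord1 !mxE eqxx mulr1n.
by congr (x _ _); exact: val_inj.
Qed.

Lemma measurable_uncons_cV n : measurable_fun setT (@uncons_cV n).
Proof.
apply/measurable_fun_pairP; split; first exact: measurable_coord.
apply/measurable_fun_cVP => i; rewrite /comp /=.
by under eq_fun do rewrite mxE; exact: measurable_coord.
Qed.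

End Measurability.

(** * Lebesgue measure on column vectors and iterated integrals *)

Section LebesgueMeasure.
Context {R : realType}.
Local Open Scope ereal_scope.

(** The recursive definition is one of set functions. Being a sigma-finite
    measure is carried through the recursion as a single property, because
    sigma-finiteness of the second factor is what makes the next product a
    measure. *)
Lemma lebesgue_cV_sigma_finite_measure n :
  exists m : {sigma_finite_measure set 'cV[R]_n -> \bar R},
    m = @lebesgue_cV R n :> (set 'cV[R]_n -> \bar R).
Proof.
elim: n => [|n [m mE]].
  by exists (\d_(0%R : 'cV[R]_0)).
pose l : {measure set (measurableTypeR R * 'cV[R]_n)%type -> \bar R} :=
  product_measure1 (@lebesgue_measure R) m.
pose mu' : {measure set 'cV[R]_n.+1 -> \bar R} :=
  pushforward l (@cons_cV R n).
pose mu := mu' (measurable_cons_cV n).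
have sf : sigma_finite setT mu.
  have /sigma_finiteP[F [TF ndF Foo]] := sigma_finiteT (@lebesgue_measure R).
  have /sigma_finiteP[G [TG ndG Goo]] := sigma_finiteT m.
  (* Both covers are increasing, so boxes with equal indices suffice. *)
  exists (fun k => @uncons_cV R n @^-1` (F k `*` G k)).
    apply/esym; rewrite -subTset => x _.
    have [i _ Fi] : (\bigcup_i F i) (x 0 0)%R by rewrite -TF.
    have [j _ Gj] : (\bigcup_i G i) (uncons_cV x).2 by rewrite -TG.
    exists (maxn i j) => //; split=> /=.
    - exact/(subsetPset _ _ (ndF _ _ (leq_maxl i j))).
    - exact/(subsetPset _ _ (ndG _ _ (leq_maxr i j))).
  move=> k; have [mF Fk] := Foo k; have [mG Gk] := Goo k; split.
    rewrite -[X in measurable X]setTI; apply: measurable_uncons_cV => //.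
    exact: measurableX.
  rewrite /mu /= /pushforward /= -comp_preimage.
  rewrite (_ : _ \o _ = id); last by apply/funext => z; exact: cons_cVK.
  by rewrite preimage_id product_measure1E// lte_mul_pinfty// ge0_fin_numE.
pose mu2 : {sigma_finite_measure set _ -> \bar R} :=
  HB.pack (Measure.sort mu)
    (Measure_isSigmaFinite.Build _ _ _ (Measure.sort mu) sf).
by exists mu2; rewrite /= -mE.
Qed.

End LebesgueMeasure.

Section LebesgueInstance.
Context {R : realType} (n : nat).
Local Notation leb := (@lebesgue_cV R n).

Let leb0 : leb set0 = 0%E.
Proof. by have [m <-] := @lebesgue_cV_sigma_finite_measure R n. Qed.

Let leb_ge0 A : (0 <= leb A)%E.
Proof. by have [m <-] := @lebesgue_cV_sigma_finite_measure R n. Qed.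

Let leb_semi_sigma_additive : semi_sigma_additive leb.
Proof.
have [m <-] := @lebesgue_cV_sigma_finite_measure R n.
exact: measure_semi_sigma_additive.
Qed.

HB.instance Definition _ := isMeasure.Build _ _ _ leb
  leb0 leb_ge0 leb_semi_sigma_additive.

Let leb_sigma_finite : sigma_finite setT leb.
Proof.
have [m <-] := @lebesgue_cV_sigma_finite_measure R n.
exact: sigma_finiteT.
Qed.

HB.instance Definition _ := Measure_isSigmaFinite.Build _ _ _ leb
  leb_sigma_finite.

End LebesgueInstance.

Section Slices.
Context {R : realType} (n : nat) (f : 'cV[R]_n.+1 -> \bar R).
Hypothesis mf : measurable_fun setT f.

Lemma measurable_slice_tail t :
  measurable_fun setT (fun y => f (cons_cV (t, y))).
Proof.
apply: (measurableT_comp mf).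
exact: (measurableT_comp (measurable_cons_cV n) (pair1_measurable t)).
Qed.

Lemma measurable_slice_head y :
  measurable_fun setT (fun t => f (cons_cV (t, y))).
Proof.
apply: (measurableT_comp mf).
exact: (measurableT_comp (measurable_cons_cV n) (pair2_measurable y)).
Qed.

End Slices.

(** Tonelli's theorem along the first coordinate, with either variable
    integrated innermost. *)
Section IntegralRecursion.
Context {R : realType} (n : nat).
Local Open Scope ereal_scope.
Variable f : 'cV[R]_n.+1 -> \bar R.
Hypotheses (mf : measurable_fun setT f) (f0 : forall x, 0 <= f x).

Let ge0_integral_lebesgue_cVX : \int[@lebesgue_cV R n.+1]_x f x =
  \int[@lebesgue_measure R \x @lebesgue_cV R n]_z f (cons_cV z).
Proof.
pose l : {measure set (measurableTypeR R * 'cV[R]_n)%type -> \bar R} :=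
  @lebesgue_measure R \x @lebesgue_cV R n.
have := @ge0_integral_pushforward _ _ _ _ _ _ (measurable_cons_cV n) l setT f
  measurableT mf (fun x _ => f0 x).
by rewrite preimage_setT.
Qed.

Let mfcons : measurable_fun setT (f \o @cons_cV R n).
Proof. by apply: measurableT_comp => //; exact: measurable_cons_cV. Qed.

Lemma ge0_integral_lebesgue_cVS : \int[@lebesgue_cV R n.+1]_x f x =
  \int[@lebesgue_measure R]_t \int[@lebesgue_cV R n]_y f (cons_cV (t, y)).
Proof.
rewrite ge0_integral_lebesgue_cVX.
by rewrite (fubini_tonelli1 (f \o @cons_cV R n))// => z; exact: f0.
Qed.

Lemma ge0_integral_lebesgue_cVS_swap : \int[@lebesgue_cV R n.+1]_x f x =
  \int[@lebesgue_cV R n]_y \int[@lebesgue_measure R]_t f (cons_cV (t, y)).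
Proof.
rewrite ge0_integral_lebesgue_cVX.
by rewrite (fubini_tonelli2 (f \o @cons_cV R n))// => z; exact: f0.
Qed.

Lemma measurable_integral_head :
  measurable_fun setT (fun t : measurableTypeR R =>
    \int[@lebesgue_cV R n]_y f (cons_cV (t, y))).
Proof.
apply: (measurable_fun_fubini_tonelli_F (f \o @cons_cV R n)) => // z.
exact: f0.
Qed.

Lemma measurable_integral_tail :
  measurable_fun setT (fun y =>
    \int[@lebesgue_measure R]_t f (cons_cV (t, y))).
Proof.
apply: (measurable_fun_fubini_tonelli_G (f \o @cons_cV R n)) => // z.
exact: f0.
Qed.

End IntegralRecursion.

(** One-dimensional affine substitution. Lebesgue measure is determined by its
    values on half-open intervals, and the rescaled image measure has the same
    values. *)
Section Affine1.
Context {R : realType}.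
Variables a b : R.
Hypothesis a0 : a != 0.

Let aff : measurableTypeR R -> measurableTypeR R := fun t => a * t + b.

Let measurable_aff : measurable_fun setT aff.
Proof. by apply: measurable_funD => //; exact: measurable_funM. Qed.

Let scaled_image : {measure set (measurableTypeR R) -> \bar R}.
Proof.
pose p : {measure set (measurableTypeR R) -> \bar R} :=
  pushforward (@lebesgue_measure R) aff.
exact: (mscale (NngNum (normr_ge0 a)) (p measurable_aff)).
Defined.

Let lebesgue_measure_affine A : measurable A ->
  lebesgue_measure A = scaled_image A.
Proof.
apply: lebesgue_measure_unique => _ [[x y]] _ <- /=.
rewrite /mscale/= /pushforward/=.
have [an|ap|] := ltgtP a 0; last by move/eqP; rewrite (negbTE a0).
  (* A negative slope reverses the interval and swaps its closed end. *)
  rewrite (_ : _ @^-1` _ = `[(y - b) / a, (x - b) / a[%classic); last first.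
    apply/seteqP; split=> t /=; rewrite !in_itv/= ler_ndivrMr// ltr_ndivlMr//
      /aff ![t * a]mulrC ltrBlDr lerBrDr andbC//.
  rewrite !lebesgue_measure_itv /= !lte_fin.
  rewrite ltr_nM2r ?invr_lt0// ltrD2r; case: ifP => _; last by rewrite mule0.
  rewrite -EFinD -EFinM; congr EFin; rewrite ltr0_norm//; field.
  exact: a0.
rewrite (_ : _ @^-1` _ = `](x - b) / a, (y - b) / a]%classic); last first.
  apply/seteqP; split=> t /=; rewrite !in_itv/= ler_pdivlMr// ltr_pdivrMr//
    /aff ![t * a]mulrC ltrBlDr lerBrDr//.
rewrite !lebesgue_measure_itv /= !lte_fin.
rewrite ltr_pM2r ?invr_gt0// ltrD2r; case: ifP => _; last by rewrite mule0.
rewrite -EFinD -EFinM; congr EFin; rewrite gtr0_norm//; field.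
exact: a0.
Qed.

Lemma ge0_integral_affine (f : measurableTypeR R -> \bar R) :
  measurable_fun setT f -> (forall t, (0 <= f t)%E) ->
  (`|a|%:E * \int[lebesgue_measure]_t f (a * t + b)%R =
  \int[lebesgue_measure]_t f t)%E.
Proof.
move=> mf f0; transitivity (\int[scaled_image]_t f t)%E; last first.
  by apply: eq_measure_integral => A mA _; exact/esym/lebesgue_measure_affine.
by rewrite /scaled_image ge0_integral_mscale//= ge0_integral_pushforward//.
Qed.

End Affine1.

(** * Linear change of variables *)

Section LinearChange.
Context {R : realType}.
Local Open Scope ereal_scope.
Local Notation leb n := (@lebesgue_cV R n).

Lemma cons_cV_shift n (v : 'cV[R]_n.+1) t (y : 'cV[R]_n) :
  (v + cons_cV (t, y))%R =
  cons_cV ((t + (uncons_cV v).1)%R, ((uncons_cV v).2 + y)%R).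
Proof.
rewrite -{1}[v]uncons_cVK /cons_cV /= (@add_col_mx _ 1).
by rewrite -raddfD addrC.
Qed.

Lemma ge0_integral_shift n (v : 'cV[R]_n) (f : 'cV[R]_n -> \bar R) :
  measurable_fun setT f -> (forall x, 0 <= f x) ->
  \int[leb n]_x f (v + x)%R = \int[leb n]_x f x.
Proof.
elim: n v f => [|n ih] v f mf f0.
  by apply: eq_integral => x _; rewrite flatmx0 [x in RHS]flatmx0.
have mfv : measurable_fun setT (fun x => f (v + x)%R).
  by apply: measurableT_comp => //; exact: measurable_addmx.
rewrite !ge0_integral_lebesgue_cVS//.
under eq_integral => t _.
  under eq_integral do rewrite cons_cV_shift.
  rewrite (ih _ (fun y => f (cons_cV ((t + (uncons_cV v).1)%R, y))))//;
    last exact: measurable_slice_tail.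
  over.
have := @ge0_integral_affine R 1%R ((uncons_cV v).1) (oner_neq0 _) _
  (measurable_integral_head _ _ mf f0).
rewrite normr1 mul1e => <-; first by under [RHS]eq_integral do rewrite mul1r.
by move=> t; exact: integral_ge0.
Qed.

(** The formula as a predicate on the matrix: it passes to products, so it can be
    verified on triangular factors. *)
Definition linear_change {n} (M : 'M[R]_n) := forall f : 'cV[R]_n -> \bar R,
  measurable_fun setT f -> (forall x, 0 <= f x) ->
  `|\det M|%:E * \int[leb n]_x f (M *m x)%R = \int[leb n]_x f x.

Lemma linear_changeM n (M N : 'M[R]_n) :
  linear_change M -> linear_change N -> linear_change (M *m N)%R.
Proof.
move=> cM cN f mf f0; rewrite det_mulmx normrM EFinM -muleA -(cM f)//.
rewrite -(cN (fun x => f (M *m x)%R))//; last first.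
  by apply: measurableT_comp => //; exact: measurable_mulmx.
by under eq_integral do rewrite -mulmxA.
Qed.

Lemma lower_mul_cons_cV n (a t : R) (w y : 'cV[R]_n) (N : 'M[R]_n) :
  ((block_mx a%:M 0 w N : 'M[R]_n.+1) *m cons_cV (t, y) =
   cons_cV (a * t, t *: w + N *m y))%R.
Proof.
rewrite /cons_cV/= (@mul_block_col _ 1 _ 1) mul0mx addr0 -scalar_mxM.
by rewrite mul_mx_scalar.
Qed.

Lemma upper_mul_cons_cV n (a t : R) (u : 'rV[R]_n) (y : 'cV[R]_n)
    (N : 'M[R]_n) :
  ((block_mx a%:M u 0 N : 'M[R]_n.+1) *m cons_cV (t, y) =
   cons_cV (a * t + \tr (u *m y), N *m y))%R.
Proof.
rewrite /cons_cV/= (@mul_block_col _ 1 _ 1) mul0mx add0r -scalar_mxM.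
by rewrite raddfD/= trace_mx11 -mx11_scalar.
Qed.

(** With the first coordinate fixed, the others undergo the change [N] followed
    by a translation; the first one is then rescaled. *)
Lemma linear_change_lower n (a : R) (w : 'cV[R]_n) (N : 'M[R]_n) :
  a != 0%R -> linear_change N ->
  linear_change (block_mx a%:M 0 w N : 'M[R]_n.+1)%R.
Proof.
move=> a0 cN f mf f0.
have mfM : measurable_fun setT
    (fun x => f ((block_mx a%:M 0 w N : 'M[R]_n.+1) *m x)%R).
  by apply: measurableT_comp => //; exact: measurable_mulmx.
rewrite !ge0_integral_lebesgue_cVS//.
rewrite (@det_lblock _ 1) det_scalar1 normrM EFinM -muleA.
rewrite -ge0_integralZl//; last 2 first.
- exact: (measurable_integral_head _ _ mfM).
- by move=> t _; exact: integral_ge0.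
under [X in _ * X]eq_integral => t _.
  under eq_integral do rewrite lower_mul_cons_cV.
  have mft := measurable_slice_tail _ _ mf (a * t)%R.
  rewrite (cN (fun y => f (cons_cV (a * t, t *: w + y)%R)))//; last first.
    by apply: (measurableT_comp mft); exact: measurable_addmx.
  rewrite (ge0_integral_shift _ _ (fun y => f (cons_cV (a * t, y)%R)))//.
  over.
rewrite -(@ge0_integral_affine R a 0%R a0 _
  (measurable_integral_head _ _ mf f0)); last first.
  by move=> t; exact: integral_ge0.
by under [in RHS]eq_integral do rewrite addr0.
Qed.

(** Same argument with the order of integration exchanged: the first coordinate
    is integrated first, and there the map is affine. *)
Lemma linear_change_upper n (a : R) (u : 'rV[R]_n) (N : 'M[R]_n) :
  a != 0%R -> linear_change N ->
  linear_change (block_mx a%:M u 0 N : 'M[R]_n.+1)%R.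
Proof.
move=> a0 cN f mf f0.
have mfM : measurable_fun setT
    (fun x => f ((block_mx a%:M u 0 N : 'M[R]_n.+1) *m x)%R).
  by apply: measurableT_comp => //; exact: measurable_mulmx.
rewrite !ge0_integral_lebesgue_cVS_swap//.
rewrite (@det_ublock _ 1) det_scalar1 normrM [X in X%:E]mulrC EFinM -muleA.
rewrite -ge0_integralZl//; last 2 first.
- exact: (measurable_integral_tail _ _ mfM).
- by move=> t _; exact: integral_ge0.
under [X in _ * X]eq_integral => y _.
  under eq_integral do rewrite upper_mul_cons_cV.
  rewrite (ge0_integral_affine _ _ a0 (fun t => f (cons_cV (t, N *m y)%R)))//;
    last exact: measurable_slice_head.
  over.
rewrite -(cN _ (measurable_integral_tail _ _ mf f0))// => y.
exact: integral_ge0.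
Qed.

(** By induction on the size, using one step of Gaussian elimination. A matrix
    with nonzero corner is lower block triangular times upper block triangular.
    A zero corner is first made nonzero by adding multiples of the other columns
    to the first one, which avoids permuting coordinates. *)
Lemma linear_change_unit n (M : 'M[R]_n) : M \in unitmx -> linear_change M.
Proof.
elim: n M => [|n ih] M uM.
  move=> f mf f0; rewrite det_mx00 normr1 mul1e; apply: eq_integral => x _.
  by rewrite flatmx0 [x in RHS]flatmx0.
have uE w : (block_mx 1%:M 0 w 1%:M : 'M[R]_(1 + n)) \in unitmx.
  by rewrite unitmxE (@det_lblock _ 1) !det1 mulr1 unitr1.
have cE (w : 'cV[R]_n) : @linear_change n.+1 (block_mx 1%:M 0 w 1%:M)%R.
  by apply: linear_change_lower; [exact: oner_neq0|apply: ih; exact: unitmx1].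
have corner (L : 'M[R]_(1 + n)) : L \in unitmx -> \tr (ulsubmx L) != 0%R ->
    @linear_change n.+1 L.
  move=> uL; set a := \tr _ => a0.
  have aE : ulsubmx L = a%:M%R.
    by rewrite {1}[ulsubmx L]mx11_scalar /a trace_mx11.
  pose w := (a^-1 *: dlsubmx L)%R.
  pose N := (drsubmx L - w *m ursubmx L)%R.
  have LE : L = (block_mx 1%:M 0 w 1%:M *m block_mx a%:M (ursubmx L) 0 N)%R.
    rewrite (@mulmx_block _ 1 n 1 n 1 n) !mul1mx !mul0mx !addr0.
    rewrite mul_mx_scalar scalerA divff// scale1r subrKC -aE.
    by rewrite -[LHS]submxK.
  rewrite LE; apply: linear_changeM => //.
  apply: linear_change_upper => //; apply: ih.
  move: uL; rewrite LE unitmx_mul uE /= unitmxE (@det_ublock _ 1).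
  by rewrite unitrM -unitmxE => /andP[].
have [w Mw] : exists w, \tr (ulsubmx ((M : 'M[R]_(1 + n)) *m
    block_mx 1%:M 0 w 1%:M)%R) != 0%R.
  have [a0|a0] := eqVneq (\tr (ulsubmx (M : 'M[R]_(1 + n)))) 0%R; last first.
    exists 0%R; rewrite -(@submxK _ 1 n 1 n M) (@mulmx_block _ 1 n 1 n 1 n).
    by rewrite block_mxKul mulmx1 mulmx0 addr0.
  pose u := ursubmx (M : 'M[R]_(1 + n)).
  have u0 : u != 0%R.
    apply: contraTneq uM => u0.
    rewrite unitmxE -(@submxK _ 1 n 1 n M) -/u u0 (@det_lblock _ 1).
    by rewrite [ulsubmx _]mx11_scalar -trace_mx11 a0 det_scalar1 mul0r unitr0.
  (* The corner becomes the squared length of the rest of the first row. *)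
  exists u^T%R; rewrite -(@submxK _ 1 n 1 n M) (@mulmx_block _ 1 n 1 n 1 n).
  rewrite block_mxKul mulmx1 raddfD/= a0 add0r -/u.
  apply: contraNneq u0; rewrite trace_mx11 [(u *m u^T)%R 0%R 0%R]mxE => /eqP.
  under eq_bigr do rewrite [trmx u _ _]mxE -expr2.
  rewrite psumr_eq0 => [/allP u0|j _]; last exact: sqr_ge0.
  apply/eqP/matrixP => i j; rewrite ord1 [RHS]mxE.
  by have := u0 j (mem_index_enum j); rewrite sqrf_eq0 => /eqP.
have EK : (block_mx 1%:M 0 w 1%:M *m block_mx 1%:M 0 (- w) 1%:M = 1%:M
    :> 'M[R]_(1 + n))%R.
  rewrite (@mulmx_block _ 1 n 1 n 1 n) !mul1mx !mul0mx !addr0.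
  by rewrite mulmx0 mulmx1 add0r subrr -scalar_mx_block.
have -> : (M = (M *m block_mx 1%:M 0 w 1%:M) *m block_mx 1%:M 0 (- w) 1%:M)%R.
  by rewrite -mulmxA EK mulmx1.
apply: linear_changeM => //; apply: corner => //.
by rewrite unitmx_mul uM uE.
Qed.

End LinearChange.

(** * Positive definite matrices *)

Section Posdef.
Context {R : realType}.

Lemma posdefmx_unit n (S : 'M[R]_n) : posdefmx S -> S \in unitmx.
Proof.
move=> [ST Spos]; rewrite -row_free_unit -kermx_eq0; apply/rowV0P => v.
move=> /sub_kermxP vS; apply/eqP; apply: contraT => v0.
have /Spos : v^T != 0 by rewrite trmx_eq0.
by rewrite trmxK vS mul0mx mxE ltxx.
Qed.

Lemma posdefmx_congr m n (S : 'M[R]_n) (A : 'M[R]_(m, n)) :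
  posdefmx S -> row_free A -> posdefmx (A *m S *m A^T).
Proof.
move=> [ST Spos] fA; split; first by rewrite !trmx_mul trmxK ST mulmxA.
move=> x x0; have := Spos (A^T *m x); rewrite trmx_mul trmxK !mulmxA; apply.
apply: contra_neq x0 => Ax; apply: trmx_inj; apply: (row_free_inj fA).
by rewrite trmx0 mul0mx -[RHS]trmx0 -Ax trmx_mul trmxK.
Qed.

Lemma posdefmx_drsub k q (S : 'M[R]_(k + q)) :
  posdefmx S -> posdefmx (drsubmx S).
Proof.
move=> pS.
have -> : drsubmx S = row_mx 0 1%:M *m S *m (row_mx 0 1%:M)^T.
  rewrite -{2}[S]submxK mul_row_block tr_row_mx mul_row_col.
  by rewrite !mul0mx !mul1mx !add0r trmx0 mulmx0 trmx1 mulmx1 add0r.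
apply: posdefmx_congr => //; apply/row_freeP; exists (col_mx 0 1%:M).
by rewrite mul_row_col mul0mx mul1mx add0r.
Qed.

End Posdef.

(** * Normal densities under linear maps *)

Section Pdf.
Context {R : realType}.

Lemma normal_cV_pdf_ge0 n (m : 'cV[R]_n) S x : 0 <= normal_cV_pdf m S x.
Proof. by rewrite /normal_cV_pdf mulr_ge0 ?expR_ge0// invr_ge0 sqrtr_ge0. Qed.

Lemma measurable_normal_cV_pdf n (S : 'M[R]_n) :
  measurable_fun setT (normal_cV_pdf 0 S).
Proof.
apply: measurable_funM => //; apply: measurableT_comp => //.
apply: measurable_funM => //; apply: measurableT_comp => //.
rewrite (_ : (fun x => _) =
    fun x : 'cV[R]_n => \sum_j (\sum_i x i 0 * invmx S i j) * x j 0).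
  apply: measurable_sum => j.
  apply: measurable_funM; last exact: measurable_coord.
  apply: measurable_sum => i.
  by apply: measurable_funM => //; exact: measurable_coord.
apply/funext => x; rewrite subr0 mxE; apply: eq_bigr => j _.
by rewrite mxE; congr (_ * _); apply: eq_bigr => i _; rewrite mxE.
Qed.

(** The quadratic form is unchanged, since [A] cancels against the inverse of
    [A *m S *m A^T]; the determinant in the normalizing constant absorbs the
    Jacobian. *)
Lemma normal_cV_pdf_congr n (S A : 'M[R]_n) x :
  S \in unitmx -> A \in unitmx ->
  `|\det A| * normal_cV_pdf 0 (A *m S *m A^T) (A *m x) = normal_cV_pdf 0 S x.
Proof.
move=> uS uA; rewrite /normal_cV_pdf mulrA !subr0; congr (_ * expR (- _ / _)).
  rewrite !det_mulmx det_tr.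
  have -> : (2 * pi) ^+ n * (\det A * \det S * \det A) =
     (\det A) ^+ 2 * ((2 * pi) ^+ n * \det S) :> R by ring.
  rewrite sqrtrM ?sqr_ge0// sqrtr_sqr invfM mulrA divff ?mul1r//.
  by rewrite normr_eq0 -unitfE -unitmxE.
rewrite trmx_mul !mulmxA.
have -> : invmx (A *m S *m A^T) = invmx A^T *m invmx S *m invmx A.
  have uT : A^T \in unitmx by rewrite unitmx_tr.
  have uAS : A *m S *m A^T \in unitmx by rewrite !unitmx_mul uA uS uT.
  rewrite -[RHS](mulKmx uAS).
  suff -> : A *m S *m A^T *m (invmx A^T *m invmx S *m invmx A) = 1%:M.
    by rewrite mulmx1.
  by rewrite !mulmxA (mulmxK uT) (mulmxK uS) mulmxV.
by rewrite !mulmxA mulmxK ?unitmx_tr// mulmxKV.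
Qed.

(** The case of a first coordinate independent of the others, from which the
    general conditional law is obtained by a shear. *)
Lemma normal_cV_pdf_diag n (s : R) (N : 'M[R]_n) (t : R) (y : 'cV[R]_n) :
  0 < s -> N \in unitmx ->
  @normal_cV_pdf R n.+1 0 (@block_mx R 1 n 1 n s%:M 0 0 N) (cons_cV (t, y)) =
  normal_pdf 0 (Num.sqrt s) t * normal_cV_pdf 0 N y.
Proof.
move=> s0 uN; have ss0 : Num.sqrt s != 0 by rewrite gt_eqF ?sqrtr_gt0.
rewrite normal_pdfE// /normal_peak /normal_fun /normal_cV_pdf.
rewrite mulrACA -expRD sqr_sqrtr ?ltW// !subr0 -invfM.
rewrite -sqrtrM; last by rewrite mulrn_wge0// mulr_ge0 ?pi_ge0 ?ltW.
have -> : invmx (@block_mx R 1 n 1 n s%:M 0 0 N) =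
    block_mx s^-1%:M 0 0 (invmx N).
  rewrite -invmx_scalar; apply: invmx_block_diag.
  rewrite unitmxE (@det_ublock _ 1) unitrM -!unitmxE uN.
  by rewrite unitmxE det_scalar1 unitfE gt_eqF.
congr ((Num.sqrt _)^-1 * expR _).
  rewrite (@det_ublock _ 1) det_scalar1 exprS; ring.
rewrite /cons_cV/= (@tr_col_mx _ 1) tr_scalar_mx (@mul_row_block _ _ 1 n 1 n).
rewrite !mulmx0 addr0 add0r (@mul_row_col _ _ 1 n) -!scalar_mxM.
rewrite !mxE eqxx mulr1n.
by field; rewrite gt_eqF.
Qed.

(** Block elimination: [l] holds the regression coefficients of the first
    coordinate on the others, and [s], the Schur complement, is its conditional
    variance. Positivity of [s] is what makes the conditional law a
    non-degenerate one-dimensional normal law. *)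
Lemma posdefmx_schur n (S : 'M[R]_(1 + n)) : posdefmx S ->
  exists l : 'rV[R]_n, exists2 s : R, 0 < s &
    S = @block_mx R 1 n 1 n 1%:M l 0 1%:M *m
        block_mx s%:M 0 0 (drsubmx S) *m
        (@block_mx R 1 n 1 n 1%:M l 0 1%:M)^T.
Proof.
move=> pS; have [ST _] := pS.
have uN := posdefmx_unit _ _ (posdefmx_drsub _ _ _ pS).
pose u := ursubmx S; pose N := drsubmx S; pose l := u *m invmx N.
have NT : N^T = N by rewrite /N -[in RHS]ST trmx_drsub.
have uT : dlsubmx S = u^T by rewrite /u trmx_ursub ST.
pose s := \tr (ulsubmx S - l *m u^T).
pose V : 'M[R]_(1 + n) := @block_mx R 1 n 1 n 1%:M (- l) 0 1%:M.
pose U : 'M[R]_(1 + n) := @block_mx R 1 n 1 n 1%:M l 0 1%:M.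
have UV : U *m V = 1%:M.
  rewrite mulmx_block !mul1mx !mul0mx !mulmx0 mulmx1 !addr0 add0r addrC subrr.
  by rewrite -scalar_mx_block.
have VST : V *m S *m V^T = block_mx s%:M 0 0 N.
  rewrite -{1}[S]submxK uT -/u -/N tr_block_mx !trmx1 trmx0.
  rewrite !mulmx_block !mul1mx !mul0mx !mulmx1 !mulmx0 !add0r.
  have -> : u + - l *m N = 0.
    by rewrite mulNmx /l mulmxKV ?subrr.
  rewrite mul0mx addr0 raddfN/= mulmxN /l trmx_mul trmx_inv NT.
  rewrite mulKVmx// addrN; congr block_mx.
  by rewrite /s trace_mx11 -mx11_scalar mulNmx.
have fV : row_free V.
  by rewrite row_free_unit; case: (mulmx1_unit UV).
exists l, s.
  have [_ pos] := posdefmx_congr _ _ _ V pS fV.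
  have /pos : cons_cV (1, 0) != 0 :> 'cV[R]_(1 + n).
    apply: contra_neq (oner_neq0 R) => /(congr1 uncons_cV).
    by rewrite cons_cVK => -[->]; rewrite mxE.
  rewrite VST /cons_cV/= (@tr_col_mx _ 1) (@mul_row_block _ _ 1 n 1 n).
  rewrite (@mul_row_col _ _ 1 n) !mulmx0 !addr0 tr_scalar_mx -!scalar_mxM.
  by rewrite mul1r mulr1 mxE eqxx mulr1n.
rewrite -/N -/U -VST !mulmxA UV mul1mx -mulmxA -trmx_mul.
by rewrite UV trmx1 mulmx1.
Qed.

End Pdf.

(** * Marginals of normal densities *)

Section Marginal.
Context {R : realType}.
Local Open Scope ereal_scope.
Local Notation leb n := (@lebesgue_cV R n).

(** The density factors as the density of the last coordinates times a
    one-dimensional normal density in the first coordinate, with mean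
    depending on the others; the latter integrates to one. *)
Lemma normal_marginal1 n (S : 'M[R]_(1 + n)) (g : 'cV[R]_n -> \bar R) :
  posdefmx S -> measurable_fun setT g -> (forall y, 0 <= g y) ->
  \int[leb n.+1]_x ((@normal_cV_pdf R n.+1 0 S x)%:E * g (@dsubmx _ 1 n 1 x)) =
  \int[leb n]_y ((normal_cV_pdf 0 (drsubmx S) y)%:E * g y).
Proof.
move=> pS mg g0.
have [l [s s0 SE]] := posdefmx_schur _ _ pS.
have uN := posdefmx_unit _ _ (posdefmx_drsub _ _ _ pS).
pose c (y : 'cV[R]_n) := \tr (l *m y)%R.
have pdfS t y : (@normal_cV_pdf R n.+1 0 S (cons_cV (t, y)) =
   normal_pdf (c y) (Num.sqrt s) t * normal_cV_pdf 0 (drsubmx S) y)%R.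
  pose U : 'M[R]_(1 + n) := @block_mx R 1 n 1 n 1%:M l 0 1%:M.
  have dU : \det U = 1%R by rewrite (@det_ublock _ 1) !det1 mulr1.
  (* The shear subtracts the conditional mean from the first coordinate. *)
  have -> : cons_cV (t, y) = (U *m cons_cV ((t - c y)%R, y))%R.
    by rewrite upper_mul_cons_cV mul1r mul1mx subrK.
  rewrite {1}SE -/U -[LHS]mul1r -normr1 -{1}dU.
  rewrite normal_cV_pdf_congr//; last 2 first.
  - rewrite unitmxE (@det_ublock _ 1) unitrM -!unitmxE uN.
    by rewrite unitmxE det_scalar1 unitfE gt_eqF.
  - by rewrite unitmxE dU unitr1.
  rewrite normal_cV_pdf_diag//; congr (_ * _)%R.
  by rewrite !normal_pdfE ?gt_eqF ?sqrtr_gt0// /normal_fun subr0.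
have mf : measurable_fun setT (fun x : 'cV[R]_n.+1 =>
    (@normal_cV_pdf R n.+1 0 S x)%:E * g (@dsubmx _ 1 n 1 x)).
  apply: emeasurable_funM.
    by apply/measurable_EFinP; exact: measurable_normal_cV_pdf.
  apply: (measurableT_comp mg).
  apply: (measurableT_comp measurable_snd (measurable_uncons_cV n)).
rewrite ge0_integral_lebesgue_cVS_swap//; last first.
  by move=> x; rewrite mule_ge0// lee_fin normal_cV_pdf_ge0.
apply: eq_integral => y _.
have dE t : @dsubmx _ 1 n 1 (cons_cV (t, y)) = y by exact: col_mxKd.
under eq_integral do rewrite dE pdfS EFinM -muleA.
rewrite ge0_integralZr//.
- by rewrite integral_normal_pdf mul1e.
- by apply/measurable_EFinP; exact: measurable_normal_pdf.
- by move=> t _; rewrite lee_fin normal_pdf_ge0.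
- by rewrite mule_ge0// lee_fin normal_cV_pdf_ge0.
Qed.

Lemma normal_marginal k q (S : 'M[R]_(k + q)) (g : 'cV[R]_q -> \bar R) :
  posdefmx S -> measurable_fun setT g -> (forall y, 0 <= g y) ->
  \int[leb (k + q)]_x ((normal_cV_pdf 0 S x)%:E * g (dsubmx x)) =
  \int[leb q]_y ((normal_cV_pdf 0 (drsubmx S) y)%:E * g y).
Proof.
elim: k S => [|k ih] S pS mg g0.
  have dE (x : 'cV[R]_(0 + q)) : dsubmx x = x.
    by apply/matrixP => i j; rewrite mxE; congr (x _ _); exact: val_inj.
  have -> : drsubmx S = S.
    by apply/matrixP => i j; rewrite !mxE; congr (S _ _); exact: val_inj.
  by apply: eq_integral => x _; rewrite dE.
pose S' : 'M[R]_(1 + (k + q)) := S.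
have dE (x : 'cV[R]_(k.+1 + q)) :
    dsubmx x = dsubmx (@dsubmx _ 1 (k + q) 1 x).
  by apply/matrixP => i j; rewrite !mxE; congr (x _ _); exact: val_inj.
have -> : drsubmx S = drsubmx (drsubmx S').
  by apply/matrixP => i j; rewrite !mxE; congr (S _ _); exact: val_inj.
rewrite -ih//; last exact: (posdefmx_drsub 1 (k + q)).
rewrite -(normal_marginal1 _ S' (fun x => g (dsubmx x)))//.
  by apply: eq_integral => x _; rewrite dE.
exact: (measurableT_comp mg (measurable_dsubmx k q)).
Qed.

End Marginal.

(** * Linear images of normal vectors and of normal mixtures *)

Lemma row_free_complete (F : fieldType) k q (A : 'M[F]_(q, k + q)) :
  row_free A -> exists C : 'M[F]_(k, k + q), col_mx C A \in unitmx.
Proof.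
move=> /eqP rA.
have rC : \rank (A^C)%MS = k by rewrite mxrank_compl rA addnK.
exists (castmx (rC, erefl) (row_base A^C)%MS).
rewrite -row_full_unit -sub1mx -addsmxE.
have eC : (castmx (rC, erefl) (row_base A^C) :=: A^C)%MS.
  by apply: eqmx_trans (eqmx_cast _ _) (eq_row_base _).
by rewrite (adds_eqmx eC (eqmx_refl A)) addsmxC sub1mx addsmx_compl_full.
Qed.

(** Completing [A] to an invertible matrix turns [A] into the projection onto
    the last coordinates: change variables, then take the marginal. *)
Lemma integral_normal_image (R : realType) k q (S : 'M[R]_(k + q))
    (A : 'M[R]_(q, k + q)) (E : set 'cV[R]_q) :
  posdefmx S -> row_free A -> measurable E ->
  (\int[@lebesgue_cV R (k + q)]_(x in (fun x => A *m x)%R @^-1` E)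
      (normal_cV_pdf 0 S x)%:E =
   \int[@lebesgue_cV R q]_(y in E) (normal_cV_pdf 0 (A *m S *m A^T)%R y)%:E)%E.
Proof.
move=> pS fA mE.
have [C uM] := row_free_complete _ _ _ _ fA.
set M := col_mx C A in uM.
have dM : drsubmx (M *m S *m M^T) = A *m S *m A^T.
  rewrite /M tr_col_mx !mul_col_mx !mul_mx_row /drsubmx.
  by rewrite col_mxKd row_mxKr.
have pM : posdefmx (M *m S *m M^T).
  by apply: posdefmx_congr => //; rewrite row_free_unit.
have mind : measurable_fun setT (fun y => (\1_E y)%:E : \bar R).
  by apply/measurable_EFinP; exact: measurable_indic.
rewrite [RHS]integral_mkcond epatch_indic -dM.
rewrite -(normal_marginal _ _ (M *m S *m M^T) (fun y => (\1_E y)%:E))//.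
pose f (w : 'cV[R]_(k + q)) :=
  ((normal_cV_pdf 0 (M *m S *m M^T) w)%:E * (\1_E (dsubmx w))%:E)%E.
have mf : measurable_fun setT f.
  apply: emeasurable_funM.
    by apply/measurable_EFinP; exact: measurable_normal_cV_pdf.
  exact: (measurableT_comp mind (measurable_dsubmx k q)).
have f0 w : (0 <= f w)%E by rewrite mule_ge0// lee_fin// normal_cV_pdf_ge0.
rewrite -(linear_change_unit _ M uM f)// -ge0_integralZl//; last first.
  by apply: (measurableT_comp mf); exact: measurable_mulmx.
rewrite [LHS]integral_mkcond epatch_indic; apply: eq_integral => x _.
rewrite /f muleA -(normal_cV_pdf_congr _ _ M) ?(posdefmx_unit _ _ pS)// EFinM.
congr (_ * _%:E)%E.
by rewrite /M mul_col_mx col_mxKd.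
Qed.

Theorem proposition1 (R : realType) (d q : nat)
    (xi : 'cV[R]_d) (Sigma : 'M[R]_d) (gamma : 'cV[R]_d)
    (H : probability (R * R)%type R)
    (disp : measure_display) (Omega : measurableType disp)
    (P : probability Omega R) (Y : Omega -> 'cV[R]_d)
    (b : 'cV[R]_q) (B : 'M[R]_(d, q)) :
  (q <= d)%N -> \rank B = q ->
  is_GMN xi Sigma gamma H P Y ->
  is_GMN (b + B^T *m xi) (B^T *m Sigma *m B) (B^T *m gamma) H P
    (fun omega => b + B^T *m Y omega).
Proof.
move=> qd rB.
have [k dE] : exists k, d = (k + q)%N by exists (d - q)%N; rewrite subnK.
subst d => -[mY [d' [T' [P' [X [U [V [r [s]]]]]]]] /=].
(* The representation of Y yields one of its image, with the same mixing pair
   and with X replaced by B^T X. *)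
move=> [[pS XE] ind [mr ms s0] HE YE].
have fB : row_free B^T by rewrite -row_leq_rank mxrank_tr rB.
have maff : measurable_fun [set: 'cV[R]_(k + q)] (fun y => b + B^T *m y).
  exact: (measurableT_comp (measurable_addmx _ b) (measurable_mulmx _ _ _)).
have mBX : measurable_fun setT (fun t => B^T *m X t).
  by apply: (measurableT_comp (measurable_mulmx _ _ _)).
split; first exact: (measurableT_comp maff mY).
pose X' : {RV P' >-> 'cV[R]_q} := HB.pack (fun t => B^T *m X t)
  (isMeasurableFun.Build _ _ _ _ _ mBX).
exists d', T', P', X', U, V, r, s; split => //=.
- split; first by have := posdefmx_congr _ _ _ _ pS fB; rewrite trmxK.
  move=> A mA; have := integral_normal_image _ _ _ _ _ _ pS fB mA.
  rewrite trmxK => <-; rewrite -XE//.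
  by rewrite -[X in measurable X]setTI; exact: measurable_mulmx.
- move=> A1 A2 A3 mA1 mA2 mA3.
  have := ind ((fun x => B^T *m x) @^-1` A1) A2 A3; apply => //.
  by rewrite -[X in measurable X]setTI; exact: measurable_mulmx.
- move=> A mA.
  have mfA : measurable ((fun y => b + B^T *m y) @^-1` A).
    by rewrite -[X in measurable X]setTI; exact: maff.
  transitivity (pushforward P Y ((fun y => b + B^T *m y) @^-1` A)) => //.
  rewrite (YE _ mfA); congr (P' _); apply/funext => t; congr (A _).
  by rewrite !mulmxDr -!scalemxAr !addrA.
Qed.
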